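(* The validity problem of $\mathsf{BFNL^*}$ — given a $\mathsf{BFNL^*}$-formula $A$, decide whether $A$ is true at every state of every $\mathsf{BFNL^*}$-model — is PSPACE-hard.
   Context: Formulas of $\mathsf{BFNL^*}$ over a set $\mathsf{Prop}$ of propositional letters: $A::=p\mid\top\mid\bot\mid\neg A\mid A\wedge B\mid A\vee B\mid A\cdot B\mid A\backslash B\mid A/B$. A $\mathsf{BFNL^*}$-model is $\mathfrak{J}=(W,R,V)$ with $W\neq\emptyset$, $R\subseteq W^3$, $V:\mathsf{Prop}\to\wp(W)$. Satisfaction: $u\models p$ iff $u\in V(p)$; $u\not\models\bot$, $u\models\top$; $u\models\neg A$ iff $u\not\models A$; $\wedge,\vee$ classical; $u\models A\cdot B$ iff there are $v,w$ with $R(u,v,w)$, $v\models A$, $w\models B$; $u\models A/B$ iff for all $v,w$ with $R(w,u,v)$, $v\models B$ implies $w\models A$; $u\models A\backslash B$ iff for all $v,w$ with $R(v,w,u)$, $w\models A$ implies $v\models B$. *)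

(* Defs.v *)
From HB Require Import structures.
From mathcomp Require Import all_boot.

Set Implicit Arguments.
Unset Strict Implicit.
Unset Printing Implicit Defensive.

(** * Deterministic multi-tape Turing machines

    Tapes are infinite in both directions.  A tape is stored as the finite
    segment of cells that held the input or have been visited; [None] is the
    blank symbol, and every cell outside the segment is blank. *)

Inductive dir := Left | Stay | Right.

(* [tleft] lists the cells to the left of the head, nearest first. *)
Record tape (G : Type) := Tape {
  tleft : seq (option G);
  tcur : option G;
  tright : seq (option G)
}.

Definition tape_of (G : Type) (s : seq G) : tape G :=
  Tape [::] (ohead s) [seq Some a | a <- behead s].

Definition inscription (G : Type) (t : tape G) : seq (option G) :=
  rev (tleft t) ++ tcur t :: tright t.

Definition write (G : Type) (a : option G) (t : tape G) : tape G :=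
  Tape (tleft t) a (tright t).

Definition shift (G : Type) (d : dir) (t : tape G) : tape G :=
  match d with
  | Left =>
      Tape (behead (tleft t)) (head None (tleft t)) (tcur t :: tright t)
  | Stay => t
  | Right =>
      Tape (tcur t :: tleft t) (head None (tright t)) (behead (tright t))
  end.

(* The machine has [tm_tapes.+1] tapes, hence at least one. *)
Record tm := TM {
  tm_tapes : nat;
  tm_sym : finType;
  tm_state : finType;
  tm_start : tm_state;
  tm_halt : pred tm_state;
  tm_accept : pred tm_state;
  tm_trans : tm_state -> {ffun 'I_tm_tapes.+1 -> option tm_sym} ->
             tm_state * {ffun 'I_tm_tapes.+1 -> option tm_sym * dir}
}.

Record config (M : tm) := Config {
  cstate : tm_state M;
  ctapes : {ffun 'I_(tm_tapes M).+1 -> tape (tm_sym M)}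
}.

Definition halted (M : tm) (c : config M) : bool := tm_halt (cstate c).

Definition step (M : tm) (c : config M) : config M :=
  if halted c then c else
  let: (q, act) := tm_trans (cstate c) [ffun i => tcur (ctapes c i)] in
  Config q [ffun i => shift (act i).2 (write (act i).1 (ctapes c i))].

Definition init (M : tm) (s : seq (tm_sym M)) : config M :=
  Config (tm_start M) [ffun i => tape_of (if i == ord0 then s else [::])].

Definition run (M : tm) (s : seq (tm_sym M)) (t : nat) : config M :=
  iter t (@step M) (init s).

Definition space (M : tm) (c : config M) : nat :=
  \sum_(i < (tm_tapes M).+1) size (inscription (ctapes c i)).

(* The output is what is written on the last tape, up to surrounding blanks. *)
Definition outputs (M : tm) (c : config M) (s : seq (tm_sym M)) : Prop :=
  exists a b : nat, inscription (ctapes c ord_max) =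
    nseq a None ++ [seq Some x | x <- s] ++ nseq b None.

(** * Polynomial time, polynomial space, hardness *)

Definition language (S : finType) := seq S -> Prop.

(* [i] and [o] identify the input and output alphabets with subsets of the
   tape alphabet. *)
Definition polytime_computable (S T : finType) (f : seq S -> seq T) : Prop :=
  exists (M : tm) (i : S -> tm_sym M) (o : T -> tm_sym M) (c d : nat),
    injective i /\ injective o /\
    forall x : seq S, exists t : nat,
      t <= c * size x ^ d + c /\
      halted (run (map i x) t) /\
      outputs (run (map i x) t) (map o (f x)).

Definition in_PSPACE (S : finType) (L : language S) : Prop :=
  exists (M : tm) (i : S -> tm_sym M) (c d : nat),
    injective i /\
    forall x : seq S,
      (forall t : nat, space (run (map i x) t) <= c * size x ^ d + c) /\
      exists t : nat, halted (run (map i x) t) /\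
        (L x <-> tm_accept (cstate (run (map i x) t))).

Definition polytime_reducible (S T : finType)
    (K : language S) (L : language T) : Prop :=
  exists f : seq S -> seq T,
    polytime_computable f /\ forall x : seq S, K x <-> L (f x).

Definition PSPACE_hard (T : finType) (L : language T) : Prop :=
  forall (S : finType) (K : language S),
    in_PSPACE K -> polytime_reducible K L.

(** * The logic BFNL* *)

(* The set of propositional letters is taken to be countably infinite. *)
Inductive formula :=
  | Var of nat
  | Top
  | Bot
  | Neg of formula
  | And of formula & formula
  | Or of formula & formula
  | Prod of formula & formula    (* A · B *)
  | Under of formula & formula   (* A \ B *)
  | Over of formula & formula.   (* A / B *)

Record model := Model {
  world :> Type;
  world_inhabited : inhabited world;
  rel3 : world -> world -> world -> Prop;
  valuation : nat -> world -> Prop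
}.

Fixpoint sat (J : model) (u : J) (A : formula) : Prop :=
  match A with
  | Var n => valuation n u
  | Top => True
  | Bot => False
  | Neg B => ~ sat u B
  | And B C => sat u B /\ sat u C
  | Or B C => sat u B \/ sat u C
  | Prod B C => exists v w : J, rel3 u v w /\ sat v B /\ sat w C
  | Under B C => forall v w : J, rel3 v w u -> sat w B -> sat v C
  | Over B C => forall v w : J, rel3 w u v -> sat v C -> sat w B
  end.

Definition valid (A : formula) : Prop := forall (J : model) (u : J), sat u A.

(** * Formulas as words

    Formulas are written in Polish notation over a finite alphabet, the n-th
    letter being [TLetter] followed by n primes.  Writing indices in unary makes
    instances longer than binary indices would, so hardness for this encoding
    implies hardness for the binary one. *)

Inductive token :=
  | TLetter | TPrime | TTop | TBot | TNeg | TAnd | TOr | TProd | TUnder | TOver.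

Definition token_rank (a : token) : 'I_10 :=
  inord match a with
  | TLetter => 0 | TPrime => 1 | TTop => 2 | TBot => 3 | TNeg => 4
  | TAnd => 5 | TOr => 6 | TProd => 7 | TUnder => 8 | TOver => 9
  end.

Definition token_unrank (k : 'I_10) : token :=
  nth TLetter
    [:: TLetter; TPrime; TTop; TBot; TNeg; TAnd; TOr; TProd; TUnder; TOver] k.

Lemma token_rankK : cancel token_rank token_unrank.
Proof. by case; rewrite /token_unrank /token_rank inordK. Qed.

HB.instance Definition _ := Finite.copy token (can_type token_rankK).

Fixpoint encode (A : formula) : seq token :=
  match A with
  | Var n => TLetter :: nseq n TPrime
  | Top => [:: TTop]
  | Bot => [:: TBot]
  | Neg B => TNeg :: encode B
  | And B C => TAnd :: encode B ++ encode C
  | Or B C => TOr :: encode B ++ encode C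
  | Prod B C => TProd :: encode B ++ encode C
  | Under B C => TUnder :: encode B ++ encode C
  | Over B C => TOver :: encode B ++ encode C
  end.

Lemma encode_cat_inj (A B : formula) (s t : seq token) :
    ohead s <> Some TPrime -> ohead t <> Some TPrime ->
  encode A ++ s = encode B ++ t -> A = B /\ s = t.
Proof.
have hd C r : ohead (encode C ++ r) <> Some TPrime by case: C.
elim: A B s t => [n|||A IH|A IHA C IHC|A IHA C IHC|A IHA C IHC|A IHA C IHC
  |A IHA C IHC] [m|||B|B D|B D|B D|B D|B D] s t hs ht //=;
  rewrite -?catA; case=> //.
- elim: n m => [|n IHn] [|m] //=.
  + by move=> E; case: hs; rewrite E.
  + by move=> E; case: ht; rewrite -E.
  + by case=> /IHn [[->] ->].
- by case/IH => // -> ->.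
all: by case/IHA; [exact: hd|exact: hd|move=> -> /IHC [] // -> ->].
Qed.

Lemma encode_inj : injective encode.
Proof.
move=> A B E.
by have [] := @encode_cat_inj A B [::] [::] (fun h => ltac:(discriminate h))
  (fun h => ltac:(discriminate h)) (congr1 (cat^~ [::]) E).
Qed.

Definition BFNL_validity : language token :=
  fun w => exists A : formula, w = encode A /\ valid A.

(* Main.v *)
(** Let a machine decide [K] in polynomial space.  Its configuration, read from
    the heads, is a sequence of [L] squares whose evolution is local, and it
    halts within [2 ^ m] steps for some [m] of order [L].  As in Savitch's
    theorem, a state of a model stands for the claim that [2 ^ m] steps lead from
    a configuration [A] to a configuration [B]; the letters for [A] and [B] are
    derived by Horn clauses only.  The claim is split into two successor claims,
    told apart by a label on the second component of the triple: [A] goes down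
    to the first one, the last configuration of the first one is the first
    configuration of the second one, and the last configuration of the second one
    comes back up as [B].  At [m = 0] the clauses are those of a single step.
    "If [A] is initial then [B] accepts" is then valid if and only if the machine
    accepts; the countermodel consists of the pairs (m, t) of a level and a time,
    with the true configurations at times [t] and [t + 2 ^ m].

    The formula is the concatenation of regular blocks, which a program over a
    few unary counters writes in time O(L ^ 3).  Each counter is a tape. *)

Require Import Defs.
From Stdlib Require Import Classical.
From mathcomp Require Import all_boot zify.

Set Implicit Arguments.
Unset Strict Implicit.
Unset Printing Implicit Defensive.

(** * Structured programs for multi-tape machines *)

Section Programs.

Variables (k : nat) (G : finType).

Definition reads := {ffun 'I_k.+1 -> option G}.
Definition action := {ffun 'I_k.+1 -> option G * dir}.
Definition tapes := {ffun 'I_k.+1 -> tape G}.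

Inductive prog :=
  | Act of reads -> action
  | Then of prog & prog
  | While of pred reads & prog
  | Cond of pred reads & prog & prog.

(* [None] is the test of a loop or of a conditional. *)
Fixpoint pstate (p : prog) : finType :=
  match p with
  | Act _ => unit
  | Then a b => (pstate a + pstate b)%type
  | While _ a => option (pstate a)
  | Cond _ a b => option (pstate a + pstate b)
  end.

Fixpoint pstart (p : prog) : pstate p :=
  match p with
  | Act _ => tt
  | Then a b => inl (pstart a)
  | While _ _ => None
  | Cond _ _ _ => None
  end.

Definition look (T : tapes) : reads := [ffun i => tcur (T i)].

Definition perform (w : action) (T : tapes) : tapes :=
  [ffun i => shift (w i).2 (write (w i).1 (T i))].

Definition idle (r : reads) : action := [ffun i => (r i, Stay)].

Lemma perform_idle (T : tapes) : perform (idle (look T)) T = T.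
Proof. by apply/ffunP=> i; rewrite !ffunE /write /=; case: (T i). Qed.

(** A sub-program that stops hands over control within the same step, so only the tests of loops and
    conditionals cost an extra step. *)
Fixpoint pstep (p : prog) : pstate p -> reads -> option (pstate p) * action :=
  match p return pstate p -> reads -> option (pstate p) * action with
  | Act f => fun _ r => (None, f r)
  | Then a b => fun s r =>
      match s with
      | inl s => let: (o, w) := pstep s r in
          (Some (if o is Some s' then inl s' else inr (pstart b)), w)
      | inr s => let: (o, w) := pstep s r in (omap inr o, w)
      end
  | While c a => fun s r =>
      match s with
      | None => (if c r then Some (Some (pstart a)) else None, idle r)
      | Some s => let: (o, w) := pstep s r in (Some o, w)
      end
  | Cond c a b => fun s r =>
      match s with
      | None =>
          (Some (Some (if c r then inl (pstart a) else inr (pstart b))), idle r)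
      | Some (inl s) => let: (o, w) := pstep s r in (omap (Some \o inl) o, w)
      | Some (inr s) => let: (o, w) := pstep s r in (omap (Some \o inr) o, w)
      end
  end.

Definition pnext (p : prog) (x : option (pstate p) * tapes) :=
  if x.1 is Some s then
    let: (o, w) := pstep s (look x.2) in (o, perform w x.2)
  else x.

Definition reaches (p : prog) (B : nat) (x y : option (pstate p) * tapes) :=
  exists2 t, t <= B & iter t (@pnext p) x = y.

Definition exec (p : prog) (B : nat) (T T' : tapes) :=
  reaches B (Some (pstart p), T) (None, T').

Lemma reaches_trans (p : prog) (B B' : nat) (x y z : option (pstate p) * tapes) :
  reaches B x y -> reaches B' y z -> reaches (B + B') x z.
Proof.
move=> [t tB <-] [t' tB' <-]; exists (t' + t); last by rewrite iterD.
by rewrite addnC leq_add.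
Qed.

Lemma reaches_step (p : prog) (x : option (pstate p) * tapes) :
  reaches 1 x (pnext x).
Proof. by exists 1. Qed.

(* [a] idles once it has stopped whereas [p] goes on, so that only a bound on
   the number of steps is preserved. *)
Lemma reaches_embed (a p : prog) (h : option (pstate a) -> option (pstate p))
    (B : nat) (s : pstate a) (T T' : tapes) :
    (forall s T, pnext (h (Some s), T) =
       (h (pnext (Some s, T)).1, (pnext (Some s, T)).2)) ->
  reaches B (Some s, T) (None, T') -> reaches B (h (Some s), T) (h None, T').
Proof.
move=> hP [t]; elim: t B s T => [|t IHt] [|B] s T //= tB.
rewrite -iterS iterSr; have := hP s T.
case E: (pnext (Some s, T)) => [[s'|] T1] /= Eh.
  move=> /(IHt B) [//|u uB E1]; exists u.+1 => //.
  by rewrite iterSr Eh.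
have -> : iter t (@pnext a) (None, T1) = (None, T1) by elim: (t) => //= ? ->.
by case=> <-; exists 1 => //=.
Qed.

Lemma exec_act (f : reads -> action) (T : tapes) :
  exec (Act f) 1 T (perform (f (look T)) T).
Proof. exact: reaches_step. Qed.

Lemma exec_then (a b : prog) (B B' : nat) (T T1 T' : tapes) :
  exec a B T T1 -> exec b B' T1 T' -> exec (Then a b) (B + B') T T'.
Proof.
move=> ea eb; apply: (@reaches_trans (Then a b)).
  apply: (@reaches_embed a (Then a b)
    (fun o => Some (if o is Some s then inl s else inr (pstart b))) _ _ _ _ _ ea).
  by move=> s U; rewrite /pnext /=; case: pstep.
apply: (@reaches_embed b (Then a b) (omap inr) _ _ _ _ _ eb).
by move=> s U; rewrite /pnext /=; case: pstep.
Qed.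

Lemma exec_while_stop (c : pred reads) (a : prog) (T : tapes) :
  ~~ c (look T) -> exec (While c a) 1 T T.
Proof.
move=> cF; have := @reaches_step (While c a) (Some None, T).
by rewrite /pnext /= (negPf cF) perform_idle.
Qed.

Lemma exec_while_step (c : pred reads) (a : prog) (B B' : nat)
    (T T1 T' : tapes) :
    c (look T) -> exec a B T T1 -> exec (While c a) B' T1 T' ->
  exec (While c a) (B.+1 + B') T T'.
Proof.
move=> cT ea; apply: (@reaches_trans (While c a)); rewrite -add1n.
have := @reaches_step (While c a) (Some None, T).
rewrite /pnext /= cT perform_idle => /reaches_trans; apply.
apply: (@reaches_embed a (While c a) Some _ _ _ _ _ ea).
by move=> s U; rewrite /pnext /=; case: pstep.
Qed.

Lemma exec_cond (c : pred reads) (a b : prog) (B : nat) (T T' : tapes) :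
    exec (if c (look T) then a else b) B T T' ->
  exec (Cond c a b) B.+1 T T'.
Proof.
move=> e; rewrite -add1n.
have := @reaches_step (Cond c a b) (Some None, T).
rewrite /pnext /= perform_idle => /reaches_trans; apply.
case: (c (look T)) e => e.
  apply: (@reaches_embed a (Cond c a b) (omap (Some \o inl)) _ _ _ _ _ e).
  by move=> s U; rewrite /pnext /=; case: pstep.
apply: (@reaches_embed b (Cond c a b) (omap (Some \o inr)) _ _ _ _ _ e).
by move=> s U; rewrite /pnext /=; case: pstep.
Qed.

Definition machine (p : prog) : tm :=
  @TM k G (option (pstate p)) (Some (pstart p)) (fun o => ~~ o) xpred0
    (fun o r => if o is Some s then pstep s r else (None, idle r)).

Lemma machine_run (p : prog) (s : seq G) (B : nat) (T : tapes) :
    exec p B [ffun i => tape_of (if i == ord0 then s else [::])] T ->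
  exists2 t, t <= B & run (M := machine p) s t = @Config (machine p) None T.
Proof.
case=> t tB E; exists t => //.
have sim u : run (M := machine p) s u = let x := iter u (@pnext p)
    (Some (pstart p), [ffun i => tape_of (if i == ord0 then s else [::])]) in
    @Config (machine p) x.1 x.2.
  elim: u => [//|u IHu]; rewrite /run iterS -/(run _ u) IHu /= {IHu}.
  case: (iter u (@pnext p) _) => [[q|] U] //=; rewrite /step /halted /pnext /= -/(look U).
  by case: pstep.
by rewrite sim E.
Qed.

End Programs.

(** * Counters on tapes *)

Section Counters.

Variable S : finType.

Definition sym : finType := (S + token)%type.

Record store := Store { inp : seq S; regs : seq nat; out : seq token }.

(** The cells to the left of the head are unconstrained because the input is read once, from left to
    right. *)
Definition input_tape (s : seq S) (t : tape sym) :=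
  tcur t = omap inl (ohead s) /\
  tright t = [seq Some (inl a) | a <- behead s].

(* The value [n] is a stack of [n] marks whose top is under the head. *)
Definition counter_tape (n : nat) (t : tape sym) :=
  (forall i, nth None (tleft t) i = None) /\
  (forall i, nth None (tcur t :: tright t) i =
             if i < n then Some (inr TPrime) else None).

(** Unlike for the counters, the stored segment is fixed exactly, because [outputs] inspects the
    whole inscription. *)
Definition output_tape (w : seq token) (t : tape sym) :=
  t = Tape (rev [seq Some (inr a) | a <- w]) None [::].

(** Tape 0 is the input and tape 9 the output, which leaves tapes 1 to 8 to the registers. *)
Definition rtape (r : nat) : 'I_10 := inord r.+1.

Definition represents (st : store) (T : tapes 9 sym) :=
  [/\ input_tape (inp st) (T ord0),
      forall r, r < 8 -> counter_tape (nth 0 (regs st) r) (T (rtape r)) &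
      output_tape (out st) (T ord_max)].

(** A Hoare triple for total correctness with a time bound. *)
Definition triple (B : nat) (p : prog 9 sym) (st st' : store) :=
  forall T, represents st T -> exists2 T', exec p B T T' & represents st' T'.

Lemma triple_weaken (B B' : nat) (p : prog 9 sym) (st st' : store) :
  B <= B' -> triple B p st st' -> triple B' p st st'.
Proof.
move=> BB H T /H [T' [t tB E] R]; exists T' => //.
by exists t => //; apply: leq_trans BB.
Qed.

Lemma triple_then (B B' : nat) (p p' : prog 9 sym) (st st1 st' : store) :
  triple B p st st1 -> triple B' p' st1 st' -> triple (B + B') (Then p p') st st'.
Proof.
by move=> H H' T /H [T1 e /H' [T' e' R]]; exists T' => //; apply: exec_then e e'.
Qed.

(* [f j] is the store with [j] rounds to go. *)
Lemma triple_while (c : pred (reads 9 sym)) (p : prog 9 sym) (f : nat -> store)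
    (n B : nat) :
    (forall j T, j <= n -> represents (f j) T -> c (look T) = (0 < j)) ->
    (forall j, j < n -> triple B p (f j.+1) (f j)) ->
  triple (n * B.+1).+1 (While c p) (f n) (f 0).
Proof.
elim: n => [|n IHn] cP H T R.
  by exists T => //; apply: exec_while_stop; rewrite (cP 0).
have [T1 e R1] := H n (leqnn _) T R.
have [||T' e' R'] := IHn _ _ T1 R1.
- by move=> j U jn; apply: cP; apply: leqW.
- by move=> j jn; apply: H; apply: leqW.
exists T' => //; rewrite mulSn -addnS; apply: exec_while_step e e'.
by rewrite (cP n.+1).
Qed.

Definition on_tape (j : 'I_10) (f : option sym -> option sym * dir) :
    prog 9 sym :=
  Act (fun r : reads 9 sym => [ffun i => if i == j then f (r i) else (r i, Stay)]).

Definition act_on (f : option sym -> option sym * dir) (t : tape sym) :=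
  shift (f (tcur t)).2 (write (f (tcur t)).1 t).

Definition set_tape (T : tapes 9 sym) (j : 'I_10) (t : tape sym) : tapes 9 sym :=
  [ffun i => if i == j then t else T i].

Lemma exec_on_tape (j : 'I_10) (f : option sym -> option sym * dir)
    (T : tapes 9 sym) :
  exec (on_tape j f) 1 T (set_tape T j (act_on f (T j))).
Proof.
have -> : set_tape T j (act_on f (T j)) =
    perform [ffun i => if i == j then f (look T i) else (look T i, Stay)] T.
  apply/ffunP=> i; rewrite !ffunE; case: eqP => [->|_] //=.
  by rewrite /write /=; case: (T i).
exact: exec_act.
Qed.

Lemma rtape_inj (r r' : nat) : r < 8 -> r' < 8 ->
  (rtape r == rtape r') = (r == r').
Proof. by move=> h h'; rewrite -val_eqE /= !inordK ?eqSS // ltnW. Qed.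

Lemma rtape_neq0 (r : nat) : r < 8 -> (rtape r == ord0) = false.
Proof. by move=> h; rewrite -val_eqE /= inordK // ltnW. Qed.

Lemma rtape_neq_max (r : nat) : r < 8 -> (rtape r == ord_max) = false.
Proof.
by move=> h; rewrite -val_eqE /= inordK; lia.
Qed.

Lemma represents_reg (s : seq S) (g : seq nat) (w : seq token) (r n : nat)
    (T : tapes 9 sym) (t : tape sym) :
    r < 8 -> represents (Store s g w) T -> counter_tape n t ->
  represents (Store s (set_nth 0 g r n) w) (set_tape T (rtape r) t).
Proof.
move=> r8 [Ri Rr Ro] Rt; split=> /=.
- by rewrite ffunE eq_sym rtape_neq0.
- move=> r' r'8; rewrite ffunE rtape_inj // nth_set_nth /=.
  by case: eqP => // _; apply: Rr.
- by rewrite ffunE eq_sym rtape_neq_max.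
Qed.

Definition skip : prog 9 sym := Act (@idle 9 sym).

Lemma triple_skip (st : store) : triple 1 skip st st.
Proof.
by move=> T R; exists T => //; rewrite -{2}(perform_idle T); apply: exec_act.
Qed.

Definition advance : prog 9 sym := on_tape ord0 (fun a => (a, Right)).

Lemma triple_advance (s : seq S) (g : seq nat) (w : seq token) :
  triple 1 advance (Store s g w) (Store (behead s) g w).
Proof.
move=> T [[Rc Rr] Rg Ro]; eexists; first exact: exec_on_tape.
split=> /=.
- rewrite /set_tape ffunE /input_tape /act_on /= Rr.
  by case: s {Rc Rr Rg Ro} => [|a [|b s]].
- by move=> r r8; rewrite ffunE rtape_neq0 //; apply: Rg.
- by rewrite ffunE.
Qed.

Definition emit (a : token) : prog 9 sym :=
  on_tape ord_max (fun _ => (Some (inr a), Right)).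

Lemma triple_emit (a : token) (s : seq S) (g : seq nat) (w : seq token) :
  triple 1 (emit a) (Store s g w) (Store s g (rcons w a)).
Proof.
move=> T [Ri Rg Ro]; eexists; first exact: exec_on_tape.
split=> /=.
- by rewrite ffunE.
- by move=> r r8; rewrite ffunE rtape_neq_max //; apply: Rg.
- by rewrite /set_tape ffunE /output_tape /act_on Ro /= map_rcons rev_rcons.
Qed.

Definition inc (r : nat) : prog 9 sym :=
  Then (on_tape (rtape r) (fun a => (a, Left)))
       (on_tape (rtape r) (fun _ => (Some (inr TPrime), Stay))).

Lemma triple_inc (r : nat) (s : seq S) (g : seq nat) (w : seq token) : r < 8 ->
  triple 2 (inc r) (Store s g w) (Store s (set_nth 0 g r (nth 0 g r).+1) w).
Proof.
move=> r8 T R; have [_ /(_ r r8) /= [Rl Rr] _] := R.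
exists (set_tape T (rtape r)
  (Tape (behead (tleft (T (rtape r)))) (Some (inr TPrime))
        (tcur (T (rtape r)) :: tright (T (rtape r))))).
  set T1 := set_tape T (rtape r) (act_on (fun a => (a, Left)) (T (rtape r))).
  apply: (@exec_then _ _ _ _ 1 1 _ T1); first exact: exec_on_tape.
  have := @exec_on_tape (rtape r) (fun _ => (Some (inr TPrime), Stay)) T1.
  congr exec; apply/ffunP=> i; rewrite !ffunE eqxx; by case: eqP.
apply: represents_reg => //; split=> [i|[|i]] //=.
by rewrite nth_behead Rl.
Qed.

(** Popping an empty stack only moves the head over blanks, in agreement with [0.-1 = 0]. *)
Definition dec (r : nat) : prog 9 sym :=
  on_tape (rtape r) (fun _ => (None, Right)).

Lemma triple_dec (r : nat) (s : seq S) (g : seq nat) (w : seq token) : r < 8 ->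
  triple 1 (dec r) (Store s g w) (Store s (set_nth 0 g r (nth 0 g r).-1) w).
Proof.
move=> r8 T R; have [_ /(_ r r8) /= [Rl Rr] _] := R.
eexists; first exact: exec_on_tape.
apply: represents_reg => //; split=> [[|i]|i] //=.
have := Rr i.+1; rewrite /= ltn_predRL => <-.
by case: (tright _) => [|a l] //=; case: i => //= i; rewrite nth_nil.
Qed.

Definition nonzero (r : nat) : pred (reads 9 sym) := fun R => R (rtape r) : bool.

Lemma nonzeroP (r : nat) (st : store) (T : tapes 9 sym) :
  r < 8 -> represents st T -> nonzero r (look T) = (0 < nth 0 (regs st) r).
Proof.
move=> r8 [_ /(_ r r8) [_ /(_ 0) /= E] _].
by rewrite /nonzero ffunE E; case: ifP.
Qed.

Definition current (R : reads 9 sym) : option S :=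
  if R ord0 is Some (inl a) then Some a else None.

Lemma currentP (st : store) (T : tapes 9 sym) :
  represents st T -> current (look T) = ohead (inp st).
Proof. by case=> [[E _] _ _]; rewrite /current ffunE E; case: ohead. Qed.

Lemma triple_count (r : nat) (p : prog 9 sym) (f : nat -> store) (n B : nat) :
    r < 8 -> (forall j, j <= n -> nth 0 (regs (f j)) r = j) ->
    (forall j, j < n -> triple B p (f j.+1) (f j)) ->
  triple (n * B.+1).+1 (While (nonzero r) p) (f n) (f 0).
Proof.
move=> r8 fr H; apply: triple_while H => j T jn /(nonzeroP r8) ->.
by rewrite fr.
Qed.

Definition emits (w : seq token) : prog 9 sym :=
  foldr (fun a p => Then (emit a) p) skip w.

Lemma triple_emits (v : seq token) (s : seq S) (g : seq nat) (w : seq token) :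
  triple (size v).+1 (emits v) (Store s g w) (Store s g (w ++ v)).
Proof.
elim: v w => [|a v IHv] w /=; first by rewrite cats0; apply: triple_skip.
rewrite -cat_rcons -add1n; apply: triple_then (IHv _); exact: triple_emit.
Qed.

End Counters.

Arguments triple_skip {S} st.
Arguments triple_advance {S} s g w.
Arguments triple_emit {S} a s g w.
Arguments triple_emits {S} v s g w.
Arguments triple_inc {S r} s g w.
Arguments triple_dec {S r} s g w.

(** * Writing formulas *)

Section Writing.

Variables (S : finType) (W : nat).

Fixpoint rename (h : nat -> nat) (A : formula) : formula :=
  match A with
  | Var v => Var (h v)
  | Top => Top
  | Bot => Bot
  | Neg B => Neg (rename h B)
  | And B C => And (rename h B) (rename h C)
  | Or B C => Or (rename h B) (rename h C)
  | Prod B C => Prod (rename h B) (rename h C)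
  | Under B C => Under (rename h B) (rename h C)
  | Over B C => Over (rename h B) (rename h C)
  end.

(* Each position of the configuration owns [W] letters.  In a template the
   letters below [W] are absolute, the others are counted from position [i]. *)
Definition inst (i : nat) : formula -> formula :=
  rename (fun v => if v < W then v else i * W + (v - W)).

(** Counting [r] down destroys its value; [tmp] saves it and the second loop restores it. *)
Definition loop (r tmp : nat) (p : prog 9 (sym S)) : prog 9 (sym S) :=
  Then (While (@nonzero S r) (Then (dec S r) (Then (inc S tmp) p)))
       (While (@nonzero S tmp) (Then (dec S tmp) (inc S r))).


(* [g a b j] are the registers after [j] rounds when [r] and [tmp] hold [a] and
   [b]. *)
Lemma triple_loop (r tmp : nat) (p : prog 9 (sym S)) (n B : nat) (s : seq S)
    (g : nat -> nat -> nat -> seq nat) (w : nat -> seq token) :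
    r < 8 -> tmp < 8 ->
    (forall a b j, nth 0 (g a b j) r = a) ->
    (forall a b j, nth 0 (g a b j) tmp = b) ->
    (forall a b j a', set_nth 0 (g a b j) r a' = g a' b j) ->
    (forall a b j b', set_nth 0 (g a b j) tmp b' = g a b' j) ->
    (forall a b j, j < n ->
       triple B p (Store s (g a b j) (w j)) (Store s (g a b j.+1) (w j.+1))) ->
  triple (n * (B + 8) + 2) (loop r tmp p)
    (Store s (g n 0 0) (w 0)) (Store s (g n 0 n) (w n)).
Proof.
move=> r8 t8 Hr Ht Er Et Hp.
have dr a b j : triple 1 (dec S r) (Store s (g a.+1 b j) (w j))
    (Store s (g a b j) (w j)).
  by have := triple_dec s (g a.+1 b j) (w j) r8; rewrite Hr Er.
have dt a b j : triple 1 (dec S tmp) (Store s (g a b.+1 j) (w j))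
    (Store s (g a b j) (w j)).
  by have := triple_dec s (g a b.+1 j) (w j) t8; rewrite Ht Et.
have ir a b j : triple 2 (inc S r) (Store s (g a b j) (w j))
    (Store s (g a.+1 b j) (w j)).
  by have := triple_inc s (g a b j) (w j) r8; rewrite Hr Er.
have it a b j : triple 2 (inc S tmp) (Store s (g a b j) (w j))
    (Store s (g a b.+1 j) (w j)).
  by have := triple_inc s (g a b j) (w j) t8; rewrite Ht Et.
have -> : n * (B + 8) + 2 = (n * (1 + (2 + B)).+1).+1 + (n * (1 + 2).+1).+1.
  lia.
apply: (@triple_then _ _ _ _ _ _ (Store s (g 0 n n) (w n))).
  have := @triple_count _ r (Then (dec S r) (Then (inc S tmp) p))
    (fun j => Store s (g j (n - j) (n - j)) (w (n - j))) n (1 + (2 + B)).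
  rewrite subnn subn0; apply=> // j jn; first exact: Hr.
  have -> : n - j = (n - j.+1).+1 by lia.
  apply: triple_then (dr _ _ _) _; apply: triple_then (it _ _ _) _.
  by apply: Hp; lia.
have := @triple_count _ tmp (Then (dec S tmp) (inc S r))
  (fun j => Store s (g (n - j) j n) (w n)) n (1 + 2).
rewrite subnn subn0; apply=> // j jn; first exact: Ht.
have -> : n - j = (n - j.+1).+1 by lia.
exact: triple_then (dt _ _ _) (ir _ _ _).
Qed.

(* Register 0 holds the position, register 1 is spare. *)
Definition put_var (v : nat) : prog 9 (sym S) :=
  Then (emit S TLetter)
    (if v < W then emits S (nseq v TPrime)
     else Then (loop 0 1 (emits S (nseq W TPrime)))
               (emits S (nseq (v - W) TPrime))).

Lemma triple_put_var (v i : nat) (s : seq S) (g : seq nat) (w : seq token) :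
  triple ((v + W + 13) * i.+1) (put_var v) (Store s (i :: 0 :: g) w)
    (Store s (i :: 0 :: g) (w ++ encode (inst i (Var v)))).
Proof.
apply: (@triple_weaken _ (1 + (i * (W.+1 + 8) + 2 + v.+1))); first by nia.
apply: triple_then (triple_emit _ _ _ _) _.
rewrite /= -cat_rcons; case: ifP => vW.
  apply: (@triple_weaken _ v.+1); first lia.
  by have := triple_emits (nseq v TPrime) s (i :: 0 :: g) (rcons w TLetter);
    rewrite size_nseq.
apply: (@triple_then _ _ _ _ _ _
  (Store s (i :: 0 :: g) (rcons w TLetter ++ nseq (i * W) TPrime))).
  have := @triple_loop 0 1 (emits S (nseq W TPrime)) i W.+1 s
    (fun a b _ => a :: b :: g)
    (fun j => rcons w TLetter ++ nseq (j * W) TPrime).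
  rewrite cats0; apply=> // a b j _.
  have := triple_emits (nseq W TPrime) s (a :: b :: g)
    (rcons w TLetter ++ nseq (j * W) TPrime).
  by rewrite size_nseq -catA -nseqD mulSn addnC.
rewrite nseqD catA.
have := triple_emits (nseq (v - W) TPrime) s (i :: 0 :: g)
  (rcons w TLetter ++ nseq (i * W) TPrime).
by rewrite size_nseq; apply: triple_weaken; lia.
Qed.

Fixpoint put (A : formula) : prog 9 (sym S) :=
  match A with
  | Var v => put_var v
  | Top => emit S TTop
  | Bot => emit S TBot
  | Neg B => Then (emit S TNeg) (put B)
  | And B C => Then (emit S TAnd) (Then (put B) (put C))
  | Or B C => Then (emit S TOr) (Then (put B) (put C))
  | Prod B C => Then (emit S TProd) (Then (put B) (put C))
  | Under B C => Then (emit S TUnder) (Then (put B) (put C))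
  | Over B C => Then (emit S TOver) (Then (put B) (put C))
  end.

(** The template is fixed, so only the unary indices grow, each linearly in the position; hence one
    [k] serves all positions. *)
Lemma triple_put (A : formula) : exists k, forall i s g w,
  triple (k * i.+1) (put A) (Store s (i :: 0 :: g) w)
    (Store s (i :: 0 :: g) (w ++ encode (inst i A))).
Proof.
have atom a : exists k, forall i s g w, triple (k * i.+1) (emit S a)
    (Store s (i :: 0 :: g) w) (Store s (i :: 0 :: g) (w ++ [:: a])).
  exists 1 => i s g w; rewrite cats1.
  by apply: triple_weaken _ (triple_emit _ _ _ _).
have binary a B C : (exists k, forall i s g w,
      triple (k * i.+1) (put B) (Store s (i :: 0 :: g) w)
        (Store s (i :: 0 :: g) (w ++ encode (inst i B)))) ->
    (exists k, forall i s g w,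
      triple (k * i.+1) (put C) (Store s (i :: 0 :: g) w)
        (Store s (i :: 0 :: g) (w ++ encode (inst i C)))) ->
  exists k, forall i s g w, triple (k * i.+1)
    (Then (emit S a) (Then (put B) (put C))) (Store s (i :: 0 :: g) w)
    (Store s (i :: 0 :: g)
       (w ++ a :: encode (inst i B) ++ encode (inst i C))).
  case=> kB HB [kC HC]; exists (1 + (kB + kC)) => i s g w.
  apply: (@triple_weaken _ (1 + (kB * i.+1 + kC * i.+1))); first nia.
  apply: triple_then (triple_emit _ _ _ _) _; rewrite -cat_rcons catA.
  by apply: triple_then (HB _ _ _ _) (HC _ _ _ _).
elim: A => [v|||B [kB HB]|B HB C HC|B HB C HC|B HB C HC|B HB C HC|B HB C HC];
  try exact: atom; try exact: binary.
  by exists (v + W + 13) => i s g w; apply: triple_put_var.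
exists (1 + kB) => i s g w.
apply: (@triple_weaken _ (1 + kB * i.+1)); first nia.
apply: triple_then (triple_emit _ _ _ _) _; rewrite /= -cat_rcons.
exact: HB.
Qed.

(** The alphabet is finite, so the table of [F] is compiled into a cascade of tests. *)
Definition put_at (F : option S -> formula) : prog 9 (sym S) :=
  foldr (fun o p => Cond (fun R => current R == o) (put (F o)) p) (skip S)
    (enum {: option S}).

Lemma triple_put_at (F : option S -> formula) : exists k, forall i s g w,
  triple (k * i.+1) (put_at F) (Store s (i :: 0 :: g) w)
    (Store s (i :: 0 :: g) (w ++ encode (inst i (F (ohead s))))).
Proof.
(* A cascade over a partial list is correct only for the symbols in it, which is the form that the
   induction needs. *)
suff [k Hk] : exists k, forall i s g w, ohead s \in enum {: option S} ->
  triple (k * i.+1) (put_at F) (Store s (i :: 0 :: g) w)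
    (Store s (i :: 0 :: g) (w ++ encode (inst i (F (ohead s))))).
  by exists k => i s g w; apply: Hk; rewrite mem_enum.
rewrite /put_at; elim: (enum _) => [|o l [k Hk]] /=; first by exists 0.
have [k' Hk'] := triple_put (F o); exists (k + k' + 1) => i s g w.
rewrite in_cons => so T R.
have [so'|so'] := boolP (ohead s == o).
  have [T' e R'] := Hk' i s g w T R.
  exists T'; last by rewrite (eqP so').
  case: (@exec_cond _ _ (fun R => current R == o) (put (F o))
    (foldr (fun o p => Cond (fun R => current R == o) (put (F o)) p) (skip S) l)
    (k' * i.+1) T T') => [|t tB E].
    by rewrite (currentP R) /= so'.
  by exists t => //; nia.
have sl : ohead s \in l by rewrite (negPf so') in so.
have [T' e R'] := Hk i s g w sl T R.
exists T' => //.
case: (@exec_cond _ _ (fun R => current R == o) (put (F o))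
  (foldr (fun o p => Cond (fun R => current R == o) (put (F o)) p) (skip S) l)
  (k * i.+1) T T') => [|t tB E].
  by rewrite (currentP R) /= (negPf so').
by exists t => //; nia.
Qed.

End Writing.

(** * The generator *)

Definition imp (A B : formula) : formula := Or (Neg A) B.

(* Registers: 0 position, 2 width, 4 number of levels left, 5 power of the size,
   7 padding still to be written; 1, 3 and 6 are spare. *)
Section Generator.

Variables (S : finType) (W : nat).
Variables (first later : option S -> formula).
Variables (stepT leafT headT goalT : formula).
Variables (c d q : nat).

Definition initial (x : seq S) (i : nat) : formula :=
  inst W i (if i == 0 then first (ohead x) else later (ohead (drop i x))).

Definition step_formula (L : nat) : formula :=
  foldr And Top [seq inst W i stepT | i <- iota 0 L].

(** The last conjunct supplies position [L], which the window around square [L.-1] reads just beyond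
    the border. *)
Definition leaf_formula (L : nat) : formula :=
  And (inst W 0 headT)
    (foldr And (inst W L (later None)) [seq inst W i leafT | i <- iota 0 L]).

(** [Under Top] is a box: it speaks of all [v] with [rel3 v w u] for some [w], the successors of
    [u]. *)
Definition levels (L m : nat) : formula :=
  iter m (fun A => And (step_formula L) (Under Top A)) (leaf_formula L).

(** The maximum with 1 gives the empty input a control square as well and keeps [n ^ d] positive. *)
Definition width (x : seq S) : nat :=
  let n := maxn (size x) 1 in n + c * n ^ d.

(** With [q] the number of values of a square, [2 ^ (q * L)] bounds the number of sequences of [L]
    squares and thus the halting time. *)
Definition reduction (x : seq S) : formula :=
  foldr imp (imp (levels (width x) (q * width x)) (inst W 0 goalT))
    [seq initial x i | i <- iota 0 (width x)].

Lemma flatten_iotaS (T : Type) (f : nat -> seq T) (a : nat) :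
  flatten [seq f i | i <- iota 0 a.+1] = flatten [seq f i | i <- iota 0 a] ++ f a.
Proof. by rewrite -addn1 iotaD map_cat flatten_cat /= cats0. Qed.

(** In Polish notation the last argument stands at the end, so right-nested formulas become
    concatenations of blocks, which a loop writes without a stack. *)
Lemma encode_imps (B : formula) (l : seq formula) :
  encode (foldr imp B l) =
  flatten [seq TOr :: TNeg :: encode A | A <- l] ++ encode B.
Proof. by elim: l => //= A l ->; rewrite catA. Qed.

Lemma encode_ands (B : formula) (l : seq formula) :
  encode (foldr And B l) = flatten [seq TAnd :: encode A | A <- l] ++ encode B.
Proof. by elim: l => //= A l ->; rewrite catA. Qed.

Lemma encode_levels (L m : nat) :
  encode (levels L m) =
  flatten (nseq m (TAnd :: encode (step_formula L) ++ [:: TUnder; TTop]))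
    ++ encode (leaf_formula L).
Proof. by elim: m => //= m ->; rewrite -!catA. Qed.

(** * Programs for the blocks of the formula *)

Definition fact (F : option S -> formula) : prog 9 (sym S) :=
  Then (emits S [:: TOr; TNeg]) (put_at W F).

Lemma triple_fact (F : option S -> formula) : exists k, forall i s g w,
  triple (k * i.+1) (fact F) (Store s (i :: 0 :: g) w)
    (Store s (i :: 0 :: g)
       (w ++ TOr :: TNeg :: encode (inst W i (F (ohead s))))).
Proof.
have [k H] := triple_put_at W F; exists (3 + k) => i s g w.
apply: (@triple_weaken _ (3 + k * i.+1)); first nia.
apply: triple_then (triple_emits _ _ _ _) _.
by have := H i s g (w ++ [:: TOr; TNeg]); rewrite -catA.
Qed.

Definition facts (x : seq S) (a : nat) : seq token :=
  flatten [seq TOr :: TNeg :: encode (initial x i) | i <- iota 0 a].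

(** Position 0 is treated apart because it holds the control, and it gets a fact even for the empty
    input. *)
Definition read_input : prog 9 (sym S) :=
  Then (Then (fact first) (Then (advance S) (inc S 0)))
    (While (fun R => current R : bool)
       (Then (fact later) (Then (advance S) (inc S 0)))).

Lemma triple_read_input : exists k, forall x (n := maxn (size x) 1),
  triple (k * n ^ 2) read_input (Store x (nseq 8 0) [::])
    (Store [::] (n :: nseq 7 0) (facts x n)).
Proof.
have [k1 H1] := triple_fact first; have [k2 H2] := triple_fact later.
exists (k1 + k2 + 8) => x n.
have n0 : 0 < n by rewrite /n leq_max orbT.
apply: (@triple_weaken _ (k1 + 3 + (n.-1 * (k2 * n + 3).+1).+1)).
  by case: n n0 => // n _; rewrite expnS expn1 /=; nia.
apply: (@triple_then _ _ _ _ _ _ (Store (behead x) (1 :: nseq 7 0) (facts x 1))).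
  apply: triple_then; first by rewrite -[k1]muln1; apply: (H1 0).
  apply: (@triple_then _ 1 2); first exact: triple_advance.
  by rewrite /facts /= cats0; apply: (@triple_inc _ 0).
have := @triple_while _ (fun R : reads 9 (sym S) => current R : bool)
  (Then (fact later) (Then (advance S) (inc S 0)))
  (fun j => Store (drop (n - j) x) ((n - j) :: nseq 7 0) (facts x (n - j)))
  n.-1 (k2 * n + 3).
have -> : n - n.-1 = 1 by lia.
rewrite subn0 drop1 drop_oversize ?leq_maxl //; apply=> [j T jn /currentP ->|j jn].
  have sd : size (drop (n - j) x) = j.
    rewrite size_drop; move: jn; rewrite /n; case: (size x) => [|[|m]]; lia.
  by rewrite -[in RHS]sd /=; case: drop.
have -> : n - j = (n - j.+1).+1 by lia.
apply: triple_then.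
  apply: triple_weaken _ (H2 _ _ _ _); rewrite leq_mul2l; lia.
apply: (@triple_then _ 1 2); first exact: triple_advance.
rewrite -drop1 drop_drop add1n.
have -> : facts x (n - j.+1).+1 = facts x (n - j.+1) ++ TOr :: TNeg ::
    encode (inst W (n - j.+1) (later (ohead (drop (n - j.+1) x)))).
  by rewrite /facts flatten_iotaS /initial; case: eqP => //; lia.
exact: (@triple_inc _ 0).
Qed.

Definition multiply : prog 9 (sym S) :=
  Then (While (@nonzero S 5) (Then (dec S 5) (loop 0 1 (inc S 6))))
       (While (@nonzero S 6) (Then (dec S 6) (inc S 5))).

Lemma triple_multiply (n p : nat) (s : seq S) (w : seq token) :
  triple (p * (10 * n + 4) + 4 * (p * n) + 2) multiply
    (Store s [:: n; 0; 0; 0; 0; p; 0; 0] w)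
    (Store s [:: n; 0; 0; 0; 0; p * n; 0; 0] w).
Proof.
have -> : p * (10 * n + 4) + 4 * (p * n) + 2 =
  (p * (1 + (n * (2 + 8) + 2)).+1).+1 + (p * n * (1 + 2).+1).+1 by lia.
apply: (@triple_then _ _ _ _ _ _
  (Store s [:: n; 0; 0; 0; 0; 0; p * n; 0] w)).
  have := @triple_count S 5 (Then (dec S 5) (loop 0 1 (inc S 6)))
    (fun j => Store s [:: n; 0; 0; 0; 0; j; (p - j) * n; 0] w) p
    (1 + (n * (2 + 8) + 2)).
  rewrite subnn subn0; apply=> // j jp.
  apply: (@triple_then _ 1); first exact: (@triple_dec _ 5).
  have := @triple_loop S 0 1 (inc S 6) n 2 s
    (fun a b i => [:: a; b; 0; 0; 0; j; (p - j.+1) * n + i; 0]) (fun=> w).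
  have -> : (p - j) * n = (p - j.+1) * n + n.
    by rewrite addnC -mulSn; congr (_ * _); lia.
  rewrite addn0; apply=> // a b i _.
  by rewrite addnS; apply: (@triple_inc _ 6).
have := @triple_count S 6 (Then (dec S 6) (inc S 5))
  (fun j => Store s [:: n; 0; 0; 0; 0; p * n - j; j; 0] w) (p * n) 3.
rewrite subnn subn0; apply=> // j jp.
apply: (@triple_then _ 1 2); first exact: (@triple_dec _ 6).
have -> : p * n - j = (p * n - j.+1).+1 by lia.
exact: (@triple_inc _ 5).
Qed.

Definition power : prog 9 (sym S) :=
  iter d (fun p => Then p multiply) (inc S 5).

Lemma triple_power (n : nat) (s : seq S) (w : seq token) : 0 < n ->
  triple (20 * d.+1 * n ^ d) power (Store s (n :: nseq 7 0) w)
    (Store s [:: n; 0; 0; 0; 0; n ^ d; 0; 0] w).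
Proof.
move=> n0; rewrite /power; elim: d => [|e IHe].
  by apply: (@triple_weaken _ 2) => //; apply: (@triple_inc _ 5).
have ne : 0 < n ^ e by rewrite expn_gt0 n0.
(* One multiplication takes [14 * n ^ e.+1 + 4 * n ^ e + 2] steps, at most [20 * n ^ e.+1] since
   [0 < n]. *)
rewrite expnSr; apply: (@triple_weaken _ (20 * e.+1 * n ^ e +
  (n ^ e * (10 * n + 4) + 4 * (n ^ e * n) + 2))).
  have : n ^ e <= n ^ e * n by rewrite leq_pmulr.
  by nia.
exact: triple_then IHe (@triple_multiply _ _ _ _).
Qed.

(** As [e] is a constant of the reduction, the rounds are unrolled in the program and need no
    register. *)
Definition repeat (e : nat) (p : prog 9 (sym S)) : prog 9 (sym S) :=
  iter e (Then p) (skip S).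

Lemma triple_repeat (e B : nat) (p : prog 9 (sym S)) (f : nat -> store S) :
    (forall j, triple B p (f j) (f j.+1)) ->
  triple (e * B + 1) (repeat e p) (f 0) (f e).
Proof.
move=> H; suff /(_ e 0) : forall e a,
  triple (e * B + 1) (repeat e p) (f a) (f (a + e)) by [].
elim=> [|i IHi] a; first by rewrite addn0; apply: triple_skip.
rewrite mulSn -addnA -(addSnnS a); apply: triple_then (IHi _); exact: H.
Qed.

Definition scale : prog 9 (sym S) :=
  While (@nonzero S 5) (Then (dec S 5) (repeat c (inc S 7))).

Lemma triple_scale (n p : nat) (s : seq S) (w : seq token) :
  triple (p * (2 * c + 3) + 1) scale
    (Store s [:: n; 0; 0; 0; 0; p; 0; 0] w)
    (Store s [:: n; 0; 0; 0; 0; 0; 0; c * p] w).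
Proof.
have := @triple_count S 5 (Then (dec S 5) (repeat c (inc S 7)))
  (fun j => Store s [:: n; 0; 0; 0; 0; j; 0; c * (p - j)] w) p
  (1 + (c * 2 + 1)).
rewrite subnn subn0 muln0 => H.
apply: triple_weaken _ (H _ _ _) => //; first lia.
move=> j jp; apply: (@triple_then _ 1); first exact: (@triple_dec _ 5).
have := @triple_repeat c 2 (inc S 7)
  (fun i => Store s [:: n; 0; 0; 0; 0; j; 0; c * (p - j.+1) + i] w).
have -> : c * (p - j) = c * (p - j.+1) + c.
  by rewrite addnC -mulnS; congr (_ * _); lia.
by rewrite addn0; apply=> i; rewrite addnS; apply: (@triple_inc _ 7).
Qed.

Definition pad : prog 9 (sym S) :=
  While (@nonzero S 7) (Then (dec S 7) (Then (fact later) (inc S 0))).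

Lemma triple_pad : exists k, forall x n N, 0 < n -> size x <= n ->
  triple (k * (n + N) ^ 2) pad
    (Store [::] [:: n; 0; 0; 0; 0; 0; 0; N] (facts x n))
    (Store [::] (n + N :: nseq 7 0) (facts x (n + N))).
Proof.
have [k H] := triple_fact later; exists (k + 5) => x n N n0 xn.
have := @triple_count S 7 (Then (dec S 7) (Then (fact later) (inc S 0)))
  (fun j => Store [::] [:: n + (N - j); 0; 0; 0; 0; 0; 0; j]
     (facts x (n + (N - j)))) N (1 + (k * (n + N) + 2)).
rewrite subnn subn0 addn0 => H'.
apply: triple_weaken _ (H' _ _ _) => // [|j jN].
  have NX := leq_addl n N; have X0 : 0 < n + N by lia.
  move: (n + N) X0 NX => X X0 NX; rewrite expnS expn1.
  by have := leq_mul NX (leqnn (k * X)); nia.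
apply: (@triple_then _ 1); first exact: (@triple_dec _ 7).
have -> : n + (N - j) = (n + (N - j.+1)).+1 by lia.
apply: triple_then.
  apply: triple_weaken _ (H _ _ _ _); rewrite leq_mul2l; lia.
have -> : facts x (n + (N - j.+1)).+1 = facts x (n + (N - j.+1)) ++ TOr ::
    TNeg :: encode (inst W (n + (N - j.+1)) (later None)).
  rewrite /facts flatten_iotaS /initial drop_oversize; last lia.
  by case: eqP => //; lia.
exact: (@triple_inc _ 0).
Qed.

Definition copy : prog 9 (sym S) :=
  loop 0 1 (Then (inc S 2) (repeat q (inc S 4))).

Lemma triple_copy (L : nat) (s : seq S) (w : seq token) :
  triple (L * (2 * q + 11) + 2) copy (Store s (L :: nseq 7 0) w)
    (Store s [:: L; 0; L; 0; q * L; 0; 0; 0] w).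
Proof.
have := @triple_loop S 0 1 (Then (inc S 2) (repeat q (inc S 4))) L
  (2 + (q * 2 + 1)) s (fun a b j => [:: a; b; j; 0; q * j; 0; 0; 0]) (fun=> w).
rewrite muln0 => H; apply: triple_weaken _ (H _ _ _ _ _ _ _) => //; first nia.
move=> a b j _; apply: (@triple_then _ 2); first exact: (@triple_inc _ 2).
have := @triple_repeat q 2 (inc S 4)
  (fun i => Store s [:: a; b; j.+1; 0; q * j + i; 0; 0; 0] w).
rewrite addn0 (mulnSr q j); apply=> i.
by rewrite addnS; apply: (@triple_inc _ 4).
Qed.

Definition clear : prog 9 (sym S) := While (@nonzero S 0) (dec S 0).

Lemma triple_clear (n : nat) (s : seq S) (g : seq nat) (w : seq token) :
  triple (2 * n + 1) clear (Store s (n :: g) w) (Store s (0 :: g) w).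
Proof.
rewrite mulnC addn1.
apply: (@triple_count S 0 (dec S 0) (fun j => Store s (j :: g) w) n 1) => // j _.
exact: (@triple_dec _ 0).
Qed.

Definition sweep (A : formula) : prog 9 (sym S) :=
  loop 2 3 (Then (emit S TAnd) (Then (put S W A) (inc S 0))).

Lemma triple_sweep (A : formula) : exists k, forall L s m w, 0 < L ->
  triple (k * L ^ 2) (sweep A) (Store s [:: 0; 0; L; 0; m; 0; 0; 0] w)
    (Store s [:: L; 0; L; 0; m; 0; 0; 0]
       (w ++ flatten [seq TAnd :: encode (inst W i A) | i <- iota 0 L])).
Proof.
have [k H] := triple_put S W A; exists (k + 13) => L s m w L0.
have := @triple_loop S 2 3 (Then (emit S TAnd) (Then (put S W A) (inc S 0))) L
  (1 + (k * L + 2)) s (fun a b j => [:: j; 0; a; b; m; 0; 0; 0])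
  (fun j => w ++ flatten [seq TAnd :: encode (inst W i A) | i <- iota 0 j]).
rewrite cats0 => H'; apply: triple_weaken _ (H' _ _ _ _ _ _ _) => //.
  by rewrite expnS expn1; nia.
move=> a b j jL; apply: (@triple_then _ 1); first exact: triple_emit.
rewrite flatten_iotaS catA -cat_rcons.
apply: (@triple_then _ (k * L) 2); first apply: triple_weaken _ (H _ _ _ _).
  by rewrite leq_mul2l; lia.
exact: (@triple_inc _ 0).
Qed.

Definition block : prog 9 (sym S) :=
  Then (emit S TAnd) (Then (sweep stepT)
    (Then (emit S TTop) (Then clear (emits S [:: TUnder; TTop])))).

Lemma triple_block : exists k, forall L s m w, 0 < L ->
  triple (k * L ^ 2) block (Store s [:: 0; 0; L; 0; m; 0; 0; 0] w)
    (Store s [:: 0; 0; L; 0; m; 0; 0; 0]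
       (w ++ TAnd :: encode (step_formula L) ++ [:: TUnder; TTop])).
Proof.
have [k H] := triple_sweep stepT; exists (k + 8) => L s m w L0.
apply: (@triple_weaken _
  (1 + (k * L ^ 2 + (1 + (2 * L + 1 + 3))))).
  by rewrite expnS expn1; nia.
apply: triple_then; first exact: triple_emit.
apply: triple_then; first exact: H.
apply: triple_then; first exact: triple_emit.
apply: triple_then; first exact: triple_clear.
have -> : w ++ TAnd :: encode (step_formula L) ++ [:: TUnder; TTop] =
  rcons (rcons w TAnd ++ flatten [seq TAnd :: encode (inst W i stepT) |
    i <- iota 0 L]) TTop ++ [:: TUnder; TTop].
  by rewrite /step_formula encode_ands -map_comp -!cats1 -!catA.
exact: triple_emits.
Qed.

Definition put_levels : prog 9 (sym S) :=
  Then (While (@nonzero S 4) (Then (dec S 4) block))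
    (Then (emit S TAnd) (Then (put S W headT)
      (Then (sweep leafT) (put_at W later)))).

Lemma triple_put_levels : exists k, forall L w, 0 < L ->
  triple (k * L ^ 3) put_levels (Store [::] [:: 0; 0; L; 0; q * L; 0; 0; 0] w)
    (Store [::] [:: L; 0; L; 0; 0; 0; 0; 0] (w ++ encode (levels L (q * L)))).
Proof.
have [k1 H1] := triple_block; have [k2 H2] := triple_put S W headT.
have [k3 H3] := triple_sweep leafT; have [k4 H4] := triple_put_at W later.
exists (q * (k1 + 2) + 1 + 1 + k2 + k3 + 2 * k4) => L w L0.
apply: (@triple_weaken _ ((q * L * (1 + k1 * L ^ 2).+1).+1 +
  (1 + (k2 * 1 + (k3 * L ^ 2 + k4 * L.+1))))).
  rewrite (expnS L 2).
  have L2 : L <= L ^ 2 by rewrite expnS expn1 leq_pmulr.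
  move: (L ^ 2) L2 => X LX; have X0 : 0 < X by apply: leq_trans LX.
  have X3 : X <= L * X by rewrite leq_pmull.
  have le a b : b <= X -> a * b <= a * (L * X).
    by move=> bX; rewrite leq_mul2l (leq_trans bX X3) orbT.
  have := (le q L LX, le k2 1 X0, le k3 X (leqnn _), le k4 L LX, le k4 1 X0).
  by move=> [[[[]]]]; lia.
rewrite encode_levels; set blk := TAnd :: _.
apply: triple_then.
  have := @triple_count S 4 (Then (dec S 4) block)
    (fun j => Store [::] [:: 0; 0; L; 0; j; 0; 0; 0]
       (w ++ flatten (nseq (q * L - j) blk))) (q * L) (1 + k1 * L ^ 2).
  rewrite subnn subn0 cats0; apply=> // j jm.
  apply: (@triple_then _ 1); first exact: (@triple_dec _ 4).
  have -> : q * L - j = (q * L - j.+1) + 1 by lia.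
  by rewrite nseqD flatten_cat /= cats0 catA; apply: H1.
set w1 := w ++ flatten _.
have -> : w ++ flatten (nseq (q * L) blk) ++ encode (leaf_formula L) =
    ((rcons w1 TAnd ++ encode (inst W 0 headT)) ++
     flatten [seq TAnd :: encode (inst W i leafT) | i <- iota 0 L]) ++
    encode (inst W L (later None)).
  by rewrite /leaf_formula /= encode_ands -map_comp -!cats1 -!catA.
apply: triple_then; first exact: triple_emit.
apply: triple_then; first exact: H2.
apply: triple_then; first exact: H3.
(* The sweep has left [L] in register 0 and the input is exhausted, so [put_at] writes [later None]
   at position [L]. *)
exact: H4.
Qed.

Definition generator : prog 9 (sym S) :=
  Then read_input (Then power (Then scale (Then pad (Then copy (Then clear
    (Then (emits S [:: TOr; TNeg]) (Then put_levels (Then clear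
      (put S W goalT))))))))).

(** The levels dominate: [q * L] blocks of [L] templates each, every template costing O(L) for its
    unary indices. *)
Lemma triple_generator : 0 < c -> exists k, forall x, exists g,
  triple (k * width x ^ 3) generator (Store x (nseq 8 0) [::])
    (Store [::] g (encode (reduction x))).
Proof.
move=> c0; have [k1 H1] := triple_read_input; have [k2 H2] := triple_pad.
have [k3 H3] := triple_put_levels; have [k4 H4] := triple_put S W goalT.
exists (k1 + 20 * d.+1 + (2 * c + 3) + k2 + (2 * q + 13) + k3 + k4 + 10) => x.
eexists; set L := width x; pose n := maxn (size x) 1.
have n0 : 0 < n by rewrite /n leq_max orbT.
have xn : size x <= n by rewrite /n leq_maxl.
have nd : 0 < n ^ d by rewrite expn_gt0 n0.
have nL : n <= L by rewrite leq_addr.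
have L0 : 0 < L by apply: leq_trans nL.
apply: (@triple_weaken _ (k1 * n ^ 2 + (20 * d.+1 * n ^ d +
  (n ^ d * (2 * c + 3) + 1 + (k2 * L ^ 2 + (L * (2 * q + 11) + 2 +
  (2 * L + 1 + (3 + (k3 * L ^ 3 + (2 * L + 1 + k4 * 1)))))))))); last first.
  apply: triple_then; first exact: H1.
  apply: triple_then; first exact: triple_power.
  apply: triple_then; first exact: triple_scale.
  apply: triple_then; first exact: H2.
  apply: triple_then; first exact: triple_copy.
  apply: triple_then; first exact: triple_clear.
  apply: triple_then; first exact: triple_emits.
  apply: triple_then; first exact: H3.
  apply: triple_then; first exact: triple_clear.
  have -> : encode (reduction x) = (((facts x L ++ [:: TOr; TNeg]) ++
      encode (levels L (q * L))) ++ encode (inst W 0 goalT)).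
    by rewrite /reduction encode_imps -map_comp /= -!catA.
  exact: H4.
have X2 : L ^ 2 <= L ^ 3 by rewrite leq_pexp2l.
have X1 : L <= L ^ 3 by rewrite -{1}[L]expn1 leq_pexp2l.
have ndL : n ^ d <= L by rewrite /L /width -/n -[n ^ d]add0n leq_add // leq_pmull.
have le a b : b <= L ^ 3 -> a * b <= a * L ^ 3 by move=> bX; rewrite leq_mul2l bX orbT.
have n2 : n ^ 2 <= L ^ 3 by apply: leq_trans X2; rewrite leq_exp2r.
have ndX : n ^ d <= L ^ 3 by apply: leq_trans X1.
have := (le k1 _ n2, le (20 * d.+1) _ ndX, le (2 * c + 3) _ ndX, le k2 _ X2,
  le (2 * q + 13) _ X1, le k4 1 (leq_trans L0 X1), X1).
by move: (L ^ 3) (L ^ 2) (n ^ 2) (n ^ d) => ? ? ? ? [[[[[[]]]]]]; lia.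
Qed.

End Generator.

(** * Computations as formulas *)

Lemma sat_imp (J : model) (u : J) (A B : formula) :
  sat u (imp A B) <-> (sat u A -> sat u B).
Proof.
split=> [[nA /nA //|//]|AB].
by case: (classic (sat u A)) => [/AB|]; [right|left].
Qed.

Lemma sat_and (J : model) (u : J) (A B : formula) :
  sat u (And A B) <-> sat u A /\ sat u B.
Proof. by []. Qed.

Lemma sat_imps (J : model) (u : J) (B : formula) (f : nat -> formula)
    (s : seq nat) :
  sat u (foldr imp B [seq f i | i <- s]) <->
  ((forall i, i \in s -> sat u (f i)) -> sat u B).
Proof.
elim: s => [|a s IHs]; first by split=> // H; apply: H.
rewrite sat_imp IHs; split=> H.
  by move=> h; apply: H => [|i si]; apply: h; rewrite inE ?eqxx ?si ?orbT.
by move=> ha hs; apply: H => i; rewrite inE => /orP [/eqP -> //|/hs].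
Qed.

Lemma sat_ands (J : model) (u : J) (B : formula) (f : nat -> formula)
    (s : seq nat) :
  sat u (foldr And B [seq f i | i <- s]) <->
  (forall i, i \in s -> sat u (f i)) /\ sat u B.
Proof.
elim: s => [|a s IHs] /=; first by split=> [|[]].
rewrite IHs; split=> [[ha [hs hB]]|[h hB]].
  by split=> // i; rewrite inE => /orP [/eqP -> //|/hs].
split; first by apply: h; rewrite inE eqxx.
by split=> // i si; apply: h; rewrite inE si orbT.
Qed.

Definition conj (T : finType) (f : T -> formula) : formula :=
  foldr And Top [seq f t | t <- enum T].

Definition disj (T : finType) (P : pred T) (f : T -> formula) : formula :=
  foldr Or Bot [seq f t | t <- enum P].

Lemma sat_inst_conj (W i : nat) (T : finType) (f : T -> formula) (J : model)
    (u : J) :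
  sat u (inst W i (conj f)) <-> forall t, sat u (inst W i (f t)).
Proof.
suff H s : sat u (inst W i (foldr And Top [seq f t | t <- s])) <->
    forall t, t \in s -> sat u (inst W i (f t)).
  by rewrite H; split=> h t; [apply: h; rewrite mem_enum|move=> _; apply: h].
elim: s => [|a s IHs] //=; split=> [[ha /IHs hs] t|h].
  by rewrite inE => /orP [/eqP -> //|/hs].
split; first by apply: h; rewrite inE eqxx.
by apply/IHs => t st; apply: h; rewrite inE st orbT.
Qed.

Lemma sat_inst_disj (W i : nat) (T : finType) (P : pred T) (f : T -> formula)
    (J : model) (u : J) :
  sat u (inst W i (disj P f)) <-> exists2 t, P t & sat u (inst W i (f t)).
Proof.
suff H s : sat u (inst W i (foldr Or Bot [seq f t | t <- s])) <->
    exists2 t, t \in s & sat u (inst W i (f t)).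
  by rewrite H; split=> -[t Pt ht]; exists t => //; move: Pt; rewrite mem_enum.
elim: s => [|a s IHs] /=; first by split=> // -[].
split=> [[ha|/IHs [t st ht]]|[t]].
- by exists a; rewrite ?inE ?eqxx.
- by exists t; rewrite ?inE ?st ?orbT.
rewrite inE => /orP [/eqP -> |st ht]; first by left.
by right; apply/IHs; exists t.
Qed.

Section Computation.

(* Position 0 holds the control, whose successor [head] depends on itself and
   on position 1; the successor [cell] of any other position depends on the
   control and on a window of radius 1. *)
Variables (Q : finType) (head : Q -> Q -> Q) (cell : Q -> Q -> Q -> Q -> Q).
Variables (blank : Q) (accepting : pred Q).

Definition letters : nat := #|Q|.

(** Two letters for each value of a square, and one at offset 0, which at position 0 is the
    label. *)
Definition block_size : nat := (letters + letters).+1.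

Local Notation W := block_size.

(* [b = false] is for the first configuration of a claim, [b = true] for the
   last one.  Letter 0 labels the first half. *)
Definition offset (b : bool) (r : Q) : nat := (b * letters + enum_rank r).+1.

Definition letter (b : bool) (i : nat) (r : Q) : formula :=
  Var (i * W + offset b r).

Definition label : formula := Var 0.

(** The first summand [W] marks the letter as counted from the position, following the convention of
    [inst]. *)
Definition relative (b : bool) (e : nat) (r : Q) : formula :=
  Var (W + (e * W + offset b r)).

Definition stepT : formula :=
  conj (fun r =>
    And (imp (relative false 0 r) (Under label (relative false 0 r)))
   (And (imp (Under label (relative true 0 r)) (Under (Neg label) (relative false 0 r)))
        (imp (Under (Neg label) (relative true 0 r)) (relative true 0 r)))).

(** The control is an absolute letter, visible from every position, while the window is relative.
    The instance at [i] determines square [i.+1]. *)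
Definition leafT : formula :=
  conj (fun w : Q * Q * Q * Q => let: (c, x, y, z) := w in
    imp (letter false 0 c) (imp (relative false 0 x) (imp (relative false 1 y)
      (imp (relative false 2 z) (relative true 1 (cell c x y z)))))).

Definition headT : formula :=
  conj (fun w : Q * Q => let: (c, y) := w in
    imp (relative false 0 c) (imp (relative false 1 y) (relative true 0 (head c y)))).

Definition goalT : formula := disj accepting (letter true 0).

Lemma offset_lt (b : bool) (r : Q) : offset b r < W.
Proof. by rewrite /offset ltnS -addnS leq_add ?ltn_ord //; case: b; rewrite ?mul1n. Qed.

Lemma letter_inj (b b' : bool) (i i' : nat) (r r' : Q) :
  i * W + offset b r = i' * W + offset b' r' -> [/\ b = b', i = i' & r = r'].
Proof.
move=> E; have Ei : i = i'.
  have := congr1 (divn^~ W) E.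
  by rewrite !divnMDl // !divn_small ?offset_lt // !addn0.
have rk (s : Q) : exists2 k : nat, k = enum_rank s & k < letters.
  by have := ltn_ord (enum_rank s); exists (enum_rank s).
move: E; rewrite Ei => /addnI []; have [k kr kQ] := rk r.
have [k' kr' kQ'] := rk r'; rewrite -kr -kr'.
case: b; case: b'; rewrite ?mul0n ?mul1n ?add0n => E; try lia;

  split=> //; apply: enum_rank_inj; apply: ord_inj; apply: etrans (esym kr) _;
  apply: etrans kr'; lia.
Qed.

Lemma inst_letter (b : bool) (i : nat) (r : Q) :
  inst W i (letter b 0 r) = letter b 0 r.
Proof. by rewrite /inst /= mul0n add0n offset_lt. Qed.

Lemma inst_relative (b : bool) (i e : nat) (r : Q) :
  inst W i (relative b e r) = letter b (i + e) r.
Proof.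
rewrite /inst /relative /= ltnNge leq_addr addKn /=.
by rewrite addnA -mulnDl.
Qed.

Lemma inst_imp (i : nat) (A B : formula) :
  inst W i (imp A B) = imp (inst W i A) (inst W i B).
Proof. by []. Qed.

Lemma inst_under (i : nat) (A B : formula) :
  inst W i (Under A B) = Under (inst W i A) (inst W i B).
Proof. by []. Qed.

Lemma inst_and (i : nat) (A B : formula) :
  inst W i (And A B) = And (inst W i A) (inst W i B).
Proof. by []. Qed.

Definition instE := (inst_and, inst_imp, inst_under, inst_relative, inst_letter, addn0, addn1).

Lemma sat_stepT (J : model) (u : J) (i : nat) :
  sat u (inst W i stepT) <-> forall r,
    [/\ sat u (letter false i r) -> sat u (Under label (letter false i r)),
        sat u (Under label (letter true i r)) ->
          sat u (Under (Neg label) (letter false i r)) &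
        sat u (Under (Neg label) (letter true i r)) ->
          sat u (letter true i r)].
Proof.
rewrite sat_inst_conj; split=> H r; move: (H r); rewrite !instE !sat_and !sat_imp;
  by [case=> ? []|case].
Qed.

Lemma sat_leafT (J : model) (u : J) (i : nat) :
  sat u (inst W i leafT) <-> forall c x y z,
    sat u (letter false 0 c) -> sat u (letter false i x) ->
    sat u (letter false i.+1 y) -> sat u (letter false i.+2 z) ->
  sat u (letter true i.+1 (cell c x y z)).
Proof.
rewrite sat_inst_conj; split=> [H c x y z|H [[[c x] y] z]].
  by have := H (c, x, y, z); rewrite !instE !sat_imp addn2.
by rewrite !instE !sat_imp addn2; apply: H.
Qed.

Lemma sat_headT (J : model) (u : J) :
  sat u (inst W 0 headT) <-> forall c y,
    sat u (letter false 0 c) -> sat u (letter false 1 y) ->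
  sat u (letter true 0 (head c y)).
Proof.
rewrite sat_inst_conj; split=> [H c y|H [c y]].
  by have := H (c, y); rewrite !instE !sat_imp.
by rewrite !instE !sat_imp; apply: H.
Qed.

Lemma sat_goalT (J : model) (u : J) (i : nat) :
  sat u (inst W i goalT) <-> exists2 r, accepting r & sat u (letter true 0 r).
Proof.
by rewrite sat_inst_disj; split=> -[r ar]; rewrite ?instE => h; exists r;
  rewrite ?instE.
Qed.

Variables (v : nat -> nat -> Q) (L : nat).

Hypothesis v_head : forall t, v t.+1 0 = head (v t 0) (v t 1).
Hypothesis v_cell : forall t i,
  v t.+1 i.+1 = cell (v t 0) (v t i) (v t i.+1) (v t i.+2).
Hypothesis v_blank : forall t, v t L = blank.
Hypothesis L_gt0 : 0 < L.

(** * Claims about [2 ^ m] steps: soundness and the countermodel *)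

Section Claims.

Variables (S : finType) (later : option S -> formula).

Hypothesis later_None : later None = relative false 0 blank.

Local Notation claim := (levels W later stepT leafT headT L).

Lemma sat_claim0 (J : model) (u : J) :
  sat u (claim 0) <->
  [/\ sat u (inst W 0 headT), forall i, i < L -> sat u (inst W i leafT) &
      sat u (letter false L blank)].
Proof.
rewrite /levels /= sat_ands later_None inst_relative addn0.
split=> [[? [H ?]]|[? H ?]]; split=> //.
  by move=> i iL; apply: H; rewrite mem_iota.
by split=> // i; rewrite mem_iota => /andP [_]; apply: H.
Qed.

Lemma sat_claimS (J : model) (u : J) (m : nat) :
  sat u (claim m.+1) <->
  (forall i, i < L -> sat u (inst W i stepT)) /\ sat u (Under Top (claim m)).
Proof.
rewrite /levels /= sat_ands; split=> [[[H _] ?]|[H ?]]; split=> //.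
  by move=> i iL; apply: H; rewrite mem_iota.
by split=> // i; rewrite mem_iota => /andP [_]; apply: H.
Qed.

(** The clauses only derive letters, so the true configurations propagate whatever other letters
    hold in the model. *)
Lemma claim_sound (J : model) (m t : nat) (u : J) :
    sat u (claim m) -> (forall i, i < L -> sat u (letter false i (v t i))) ->
  forall i, i < L -> sat u (letter true i (v (t + 2 ^ m) i)).
Proof.
elim: m t u => [|m IHm] t u.
  rewrite addn1 => /sat_claim0 [/sat_headT Hh Hl Hb] A.
  have {}A j : j <= L -> sat u (letter false j (v t j)).
    by rewrite leq_eqVlt => /orP [/eqP ->|/A //]; rewrite v_blank.
  case=> [|i] iL; first by rewrite v_head; apply: Hh; apply: A.
  have /sat_leafT H := Hl i (ltnW iL).
  by rewrite v_cell; apply: H; apply: A => //; lia.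
move=> /sat_claimS [Hs Hc] A.
(* Without first-half successors this box is vacuous; since the second clause takes the box itself
   as premise, successors need not exist. *)
have half i : i < L -> sat u (Under label (letter true i (v (t + 2 ^ m) i))).
  move=> iL x y Rxyu ly; apply: IHm iL; first exact: Hc Rxyu _.
  move=> j jL; have /sat_stepT /(_ (v t j)) [H _ _] := Hs j jL.
  exact: (H (A j jL)) Rxyu ly.
move=> i iL; have /sat_stepT /(_ (v (t + 2 ^ m.+1) i)) [_ _] := Hs i iL.
apply=> x y Rxyu ly; rewrite expnS mul2n -addnn addnA.
apply: IHm iL; first exact: Hc Rxyu _.
move=> j jL; have /sat_stepT /(_ (v (t + 2 ^ m) j)) [_ H _] := Hs j jL.
exact: (H (half j jL)) Rxyu ly.
Qed.

(* The state [(m, t)] claims that [2 ^ m] steps lead from time [t] to time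
   [t + 2 ^ m]; its children halve the claim, the second component of the
   triple telling which half. *)
Definition history : model :=
  @Model (nat * nat) (inhabits (0, 0))
    (fun x y u => u.1 = x.1.+1 /\ x.2 = u.2 + (if y.1 == 0 then 0 else 2 ^ x.1))
    (fun n u => n = 0 /\ u.1 = 0 \/
       exists b i, n = i * W + offset b (v (u.2 + (if b then 2 ^ u.1 else 0)) i)).

Lemma sat_history (u : history) (b : bool) (i : nat) (r : Q) :
  sat u (letter b i r) <-> r = v (u.2 + (if b then 2 ^ u.1 else 0)) i.
Proof.
split=> [[[]|[b' [i' /letter_inj [-> -> ->]]] //]|->].
  by rewrite /offset addnS.
by right; exists b, i.
Qed.

(** Offsets are positive, so letter 0 can hold only through the first disjunct of the valuation. *)
Lemma sat_history_label (u : history) : sat u label <-> u.1 = 0.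
Proof.
split=> [[[] //|[b [i]]]|u0]; first by rewrite /offset addnS.
by left.
Qed.

(** For each half, exactly one state is a successor of [(m.+1, t)], so the box evaluates a letter at
    a single state. *)
Lemma sat_history_half (m t : nat) (h b : bool) (i : nat) (r : Q)
    (l := if h then Neg label else label) :
  @sat history (m.+1, t) (Under l (letter b i r)) <->
  r = v (t + (if h then 2 ^ m else 0) + (if b then 2 ^ m else 0)) i.
Proof.
split=> [H|E x y [/succn_inj xm xt] Hl].
  pose x : history := (m, t + if h then 2 ^ m else 0).
  have /sat_history // : sat x (letter b i r).
  (* The second component has level 0 for the first half and 1 for the second, so it carries the
     label exactly when [h] is false. *)
  apply: (H x (h : nat, 0)); first by rewrite /x; case: (h).
  by rewrite /l; case: (h) => [/sat_history_label|]; last apply/sat_history_label.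
apply/sat_history; rewrite E xt -xm /=; congr (v (t + _ + _) _).
move: Hl; rewrite /l; case: (h) => [|/sat_history_label -> //].
by case: eqP => // y0 []; apply/sat_history_label.
Qed.

Lemma history_claim (m t : nat) : @sat history (m, t) (claim m).
Proof.
elim: m t => [|m IHm] t.
  apply/sat_claim0; split.
  - apply/sat_headT => c y /sat_history -> /sat_history ->.
    by apply/sat_history; rewrite /= addn0 addn1 v_head.
  - move=> i _; apply/sat_leafT => c x y z.
    move=> /sat_history -> /sat_history -> /sat_history -> /sat_history ->.
    by apply/sat_history; rewrite /= addn0 addn1 v_cell.
  - by apply/sat_history; rewrite v_blank.
apply/sat_claimS; split=> [i _|[m' t'] y [/succn_inj /= mm' _] _]; last first.
  by rewrite -mm'; apply: IHm.
apply/sat_stepT => r; split.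
- move=> /sat_history ->; apply/(sat_history_half _ _ false).
  by rewrite /= !addn0.
- move=> /(sat_history_half _ _ false) ->.
  by apply/(sat_history_half _ _ true); rewrite /= !addn0.
- move=> /(sat_history_half _ _ true) ->; apply/sat_history => /=.
  by rewrite -addnA addnn -mul2n -expnS.
Qed.

Lemma valid_claim (m : nat) :
  valid (foldr imp (imp (claim m) (inst W 0 goalT))
    [seq letter false i (v 0 i) | i <- iota 0 L]) <->
  accepting (v (2 ^ m) 0).
Proof.
split=> [H|ac J u].
  have := H history (m, 0); rewrite sat_imps sat_imp => {}H.
  have /sat_goalT [r ar /sat_history /= Er] : @sat history (m, 0) (inst W 0 goalT).
    apply: H; last exact: history_claim.
    by move=> i _; apply/sat_history.
  (* In [history] a position carries only its true value, so the accepting square is the actual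
     control. *)
  by move: ar; rewrite Er add0n.
rewrite sat_imps sat_imp => A C; apply/sat_goalT; exists (v (2 ^ m) 0) => //.
rewrite -[2 ^ m]add0n; apply: claim_sound => // i iL.
by apply: A; rewrite mem_iota.
Qed.

End Claims.

(** * A bound on the halting time *)

Definition window (t : nat) : {ffun 'I_L -> Q} := [ffun i : 'I_L => v t i].

Definition advance_window (g : {ffun 'I_L -> Q}) : {ffun 'I_L -> Q} :=
  let at_ i := if insub i is Some j then g j else blank in
  [ffun i : 'I_L => if val i is i'.+1 then
     cell (at_ 0) (at_ i') (at_ i'.+1) (at_ i'.+2) else head (at_ 0) (at_ 1)].

Lemma windowS (t : nat) : window t.+1 = advance_window (window t).
Proof.
(* No square beyond [L] is consulted, and at [L] the default [blank] is correct by [v_blank]. *)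
have wE i : i <= L ->
    (if insub i is Some j then window t j else blank) = v t i.
  case: insubP => [j _ <- _|]; first by rewrite ffunE.
  by rewrite -leqNgt => Li iL; rewrite -(v_blank t); congr v; lia.
apply/ffunP=> -[[|i] iL]; rewrite !ffunE /= !wE ?v_head ?v_cell //; lia.
Qed.

(** The window evolves deterministically on its own, so every window that occurs does so at a time
    below the number [#|Q| ^ L] of windows, and [#|Q| < 2 ^ #|Q|]. *)
Lemma early (t : nat) : exists2 t', t' < 2 ^ (#|Q| * L) & v t' 0 = v t 0.
Proof.
have wE u : window u = iter u advance_window (window 0).
  by elim: u => //= u <-; apply: windowS.
have c : fconnect advance_window (window 0) (window t).
  by rewrite [window t]wE; apply: fconnect_iter.
exists (findex advance_window (window 0) (window t)); last first.
  have : window (findex advance_window (window 0) (window t)) = window t.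
    by rewrite [LHS]wE iter_findex.
  by move/ffunP => /(_ (Ordinal L_gt0)); rewrite !ffunE.
apply: leq_trans (findex_max c) _.
apply: leq_trans (max_card _) _; rewrite card_ffun card_ord expnM leq_exp2r //.
exact: ltnW (ltn_expl _ _).
Qed.

End Computation.

(** * Turing machines as local computations *)

Section Machines.

Variable M : tm.

Local Notation k := (tm_tapes M).
Local Notation symbol := (option (tm_sym M)).

Definition control : finType := (tm_state M * {ffun 'I_k.+1 -> symbol})%type.

(* Position [i.+1] holds, for each tape, the [i]-th symbols on the left and on
   the right of the head. *)
Definition around : finType := {ffun 'I_k.+1 -> symbol * symbol}.

Definition square : finType := (control + around)%type.

(** Seen from its head, the tape moves instead of the head, which makes each step local and leaves
    no head position to record. *)
Definition view (c : config M) (i : nat) : square :=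
  if i is i'.+1 then
    inr [ffun j => (nth None (tleft (ctapes c j)) i',
                    nth None (tright (ctapes c j)) i')]
  else inl (cstate c, [ffun j => tcur (ctapes c j)]).

Definition next_head (c x : square) : square :=
  match c, x with
  | inl (s, r), inr w =>
      if tm_halt s then c else
      let: (s', act) := tm_trans s r in
      inl (s', [ffun j => match (act j).2 with
                          | Left => (w j).1
                          | Stay => (act j).1
                          | Right => (w j).2
                          end])
  | _, _ => c
  end.

(** If [x] is the control, the square is adjacent to the heads, and what shifts into it from the
    head's side is the symbol just written. *)
Definition next_cell (c x y z : square) : square :=
  match c, y, z with
  | inl (s, r), inr wy, inr wz =>
      if tm_halt s then y else
      let act := (tm_trans s r).2 in
      inr [ffun j =>
        let: (l, r) := if x is inr wx then wx j else ((act j).1, (act j).1) in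
        match (act j).2 with
        | Left => ((wz j).1, r)
        | Stay => wy j
        | Right => (l, (wz j).2)
        end]
  | _, _, _ => y
  end.

Lemma view_head (c : config M) :
  view (step c) 0 = next_head (view c 0) (view c 1).
Proof.
rewrite /step /halted /=; case: ifP => // _.
case: tm_trans => s act /=; congr (inl (s, _)); apply/ffunP => j.
by rewrite !ffunE /=; case: (act j) => a [] /=; rewrite ?nth0.
Qed.

Lemma view_cell (c : config M) (i : nat) :
  view (step c) i.+1 =
  next_cell (view c 0) (view c i) (view c i.+1) (view c i.+2).
Proof.
rewrite /step /halted /=; case: ifP => // _.
case: tm_trans => s act /=; congr inr; apply/ffunP => j.
by case: i => [|i]; rewrite !ffunE /=; case: (act j) => a [] /=;
  rewrite ?nth_behead ?ffunE.
Qed.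

Definition empty_square : square := inr [ffun=> (None, None)].

Lemma view_space (c : config M) (i : nat) :
  space c <= i -> view c i = empty_square.
Proof.
move=> ci; have size_i j : size (inscription (ctapes c j)) <= i.
  by apply: leq_trans ci; rewrite /space (bigD1 j) //= leq_addr.
(* Every inscription contains the cell under the head, so [i = 0] is impossible. *)
case: i ci size_i => [|i] _ size_i; first by have := size_i ord0; rewrite size_cat /= addnS.
congr inr; apply/ffunP=> j; have := size_i j.
rewrite !ffunE size_cat size_rev /= addnS ltnS => h.
by rewrite !nth_default //; lia.
Qed.

Definition first_square (o : symbol) : square :=
  inl (tm_start M, [ffun j => if j == ord0 then o else None]).

Definition later_square (o : symbol) : square :=
  inr [ffun j => (None, if j == ord0 then o else None)].

Lemma view_init (s : seq (tm_sym M)) (i : nat) :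
  view (@init M s) i =
  if i == 0 then first_square (ohead s) else later_square (ohead (drop i s)).
Proof.
case: i => [|i] /=.
  by congr (inl (_, _)); apply/ffunP=> j; rewrite !ffunE; case: eqP.
congr inr; apply/ffunP=> j; rewrite !ffunE; case: eqP => _ /=; last by rewrite nth_nil.
case: s => [|a s] /=; rewrite nth_nil //; congr pair.
by elim: s i => [|b s IHs] [|i] //=; rewrite ?nth_nil.
Qed.

Definition accepting_square (r : square) : bool :=
  if r is inl (s, _) then tm_accept s else false.

Lemma run_halted (s : seq (tm_sym M)) (t t' : nat) :
  t <= t' -> halted (run s t) -> run s t' = run s t.
Proof.
move=> /subnKC <- h; elim: (t' - t) => [|u IHu]; first by rewrite addn0.
by rewrite addnS /run iterS -/(run s _) IHu /step h.
Qed.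

End Machines.

(** * The polynomial-time reduction *)

Lemma ohead_map (A B : Type) (f : A -> B) (s : seq A) :
  ohead (map f s) = omap f (ohead s).
Proof. by case: s. Qed.

(** Both [n] and [n ^ d] are at most [n ^ d.+1], so the width is at most [e.+1 * n ^ d.+1]; the
    final successor accounts for the empty input, where [n] is 1. *)
Lemma width_poly (S : finType) (e d : nat) (x : seq S) :
  width e d x ^ 3 <= e.+1 ^ 3 * (size x ^ (d.+1 * 3)).+1.
Proof.
rewrite /width; set n := maxn _ 1; have n0 : 0 < n by rewrite leq_max orbT.
have nd : n ^ (d.+1 * 3) <= (size x ^ (d.+1 * 3)).+1.
  by rewrite /n; case: (size x) => [|m]; rewrite ?exp1n ?(maxn_idPl _).
apply: leq_trans (leq_mul (leqnn _) nd); rewrite expnM -expnMn leq_exp2r //.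
rewrite mulSn leq_add //; first by rewrite -{1}[n]expn1 leq_pexp2l.
by rewrite leq_mul2l leq_pexp2l ?orbT.
Qed.

Theorem theorem4 : PSPACE_hard BFNL_validity.
Proof.
move=> S K [M [i [c [d [inj_i HM]]]]].
(* The space is at most [(c + c) * n ^ d]; the successor makes the factor positive, as
   [triple_generator] requires. *)
pose Q := square M; pose e := (c + c).+1.
pose first (o : option S) := relative false 0 (first_square (omap i o) : Q).
pose later (o : option S) := relative false 0 (later_square (omap i o) : Q).
have later_None : later None = relative false 0 (empty_square M).
  by congr (relative _ _ (inr _)); apply/ffunP=> j; rewrite !ffunE if_same.
pose cl := @next_cell M; pose hd := @next_head M.
pose red := @reduction S (block_size Q) first later (@stepT Q) (leafT cl)
  (headT hd) (goalT (@accepting_square M)) e d #|Q|.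
exists (encode \o red); split; last first.
  move=> x; have [sp [t [ht Kx]]] := HM x.
  pose L := width e d x; pose v t := view (run (map i x) t).
  have L0 : 0 < L by rewrite addn_gt0 leq_max orbT.
  have vb u : v u L = empty_square M.
    apply: view_space; apply: leq_trans (sp u) _; rewrite /L /width.
    set n := maxn _ _; have n0 : 0 < n ^ d by rewrite expn_gt0 leq_max orbT.
    have : size x ^ d <= n ^ d.
      by case: (d) => // d'; rewrite leq_exp2r // leq_maxl.
    by rewrite /e; nia.
  have vh u : v u.+1 0 = hd (v u 0) (v u 1) by apply: view_head.
  have vc u j : v u.+1 j.+1 = cl (v u 0) (v u j) (v u j.+1) (v u j.+2).
    exact: view_cell.
  have redE : red x = foldr imp (imp (levels (block_size Q) later (@stepT Q)
      (leafT cl) (headT hd) L (#|Q| * L))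
      (inst (block_size Q) 0 (goalT (@accepting_square M))))
      [seq letter false j (v 0 j) | j <- iota 0 L].
    congr foldr; apply: eq_map => j; rewrite /initial /v view_init -map_drop.
    by rewrite !ohead_map; case: eqP => [->|_]; rewrite inst_relative addn0.
  have -> : K x <-> accepting_square (v (2 ^ (#|Q| * L)) 0).
    (* By [early] the halting control already occurs before time [2 ^ (#|Q| * L)], and a halted
       machine no longer changes. *)
    rewrite Kx; have [t' t'm vt'] := early vh vc vb L0 t.
    have ht' : halted (run (map i x) t').
      by case: vt' => E _; rewrite /halted E.
    have -> : v (2 ^ (#|Q| * L)) 0 = v t 0.
      by rewrite -vt' /v (run_halted (ltnW t'm) ht').
    by [].
  have := @valid_claim Q hd cl (empty_square M) (@accepting_square M) v L
    vh vc vb L0 S later later_None (#|Q| * L); rewrite -redE => <-.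
  split=> [V|[A [/encode_inj <-]] //]; by exists (red x).
have [//|kk H] := @triple_generator S (block_size Q) first later (@stepT Q)
  (leafT cl) (headT hd) (goalT (@accepting_square M)) e d #|Q| _.
pose D := d.+1 * 3; pose C := kk * (e.+1) ^ 3.
exists (machine (@generator S (block_size Q) first later (@stepT Q)
  (leafT cl) (headT hd) (goalT (@accepting_square M)) e d #|Q|)), inl, inr, C, D.
split; first by move=> ? ? [].
split; first by move=> ? ? [].
move=> x; have [g /(_ [ffun j => tape_of (if j == ord0 then map inl x else [::])])] := H x.
case=> [|T ex [_ _ HT]].
  split.
  - rewrite ffunE eqxx /input_tape /=; case: x => //= a x.
    by rewrite -map_comp.
  - move=> r r8; rewrite ffunE rtape_neq0 //= (nth_nseq 0 8 0) if_same.
    by split=> [j|[|j]] //=; rewrite nth_nil.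
  - by rewrite ffunE.
have [t tB E] := machine_run ex; exists t; rewrite E; split; last split=> //.
  apply: leq_trans tB _; rewrite /C -mulnSr -mulnA.
  by rewrite leq_mul2l width_poly orbT.
(* The output head rests on one blank cell just after the word. *)
by exists 0, 1; rewrite /= HT /inscription /= revK -map_comp.
Qed.
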